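(* Let $f:\mathbb{R}\to\mathbb{R}$ be a smooth function, and let $a\in\mathbb{R}$. (i) If $f^{(n)}(a)=0$ for all $n\in\mathbb{Z}^{>0}$, then ${}^{\bullet}f(a+D_\infty)=\{f(a)\}$. (ii) Assume that there exists some $n\in\mathbb{Z}^{>0}$ such that $f^{(n)}(a)\neq0$, and denote by $m$ the smallest such $n$. (a) If $m$ is odd, then ${}^{\bullet}f(a+D_\infty)=f(a)+D_\infty$. (b) If $m$ is even, then ${}^{\bullet}f(a+D_\infty)=f(a)+\mathrm{sgn}(f^{(m)}(a))\cdot D_\infty^{\ge0}$, where $D_\infty^{\ge0}:=\{h\in D_\infty\mid h\ge0\}$.
   Context: Fermat reals: a little-oh polynomial is a function $x:[0,\epsilon)\to\mathbb{R}$ ($\epsilon>0$ depending on $x$) such that $x(t)=r+\sum_{i=1}^k\alpha_i t^{a_i}+o(t)$ as $t\to0^+$ for some $k\in\mathbb{N}$, $\alpha_i\in\mathbb{R}$, $a_i>0$, with $r=x(0)$. Two such $x,y$ are equivalent if $x(0)=y(0)$ and $x(t)-y(t)=o(t)$; the quotient set is ${}^{\bullet}\mathbb{R}$. Every $x\in{}^{\bullet}\mathbb{R}$ is uniquely of the form $x={}^{\circ}x+\sum_{i=1}^l\beta_i t^{b_i}$ with ${}^{\circ}x\in\mathbb{R}$ (standard part), $\beta_i\in\mathbb{R}\setminus\{0\}$, $0<b_1<\cdots<b_l\le1$; allowing $\beta_i=0$ gives a quasi-decomposition. ${}^{\bullet}\mathbb{R}$ is a commutative unital ring under pointwise operations,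 containing $\mathbb{R}$ as the constants. It is totally ordered: writing $x={}^{\circ}x+\sum_{i=1}^n\alpha_it^{a_i}$, $y={}^{\circ}y+\sum_{i=1}^n\beta_it^{a_i}$ with common exponents $0<a_1<\cdots<a_n\le1$, $x\le y$ iff $({}^{\circ}x,\alpha_1,\ldots,\alpha_n)\le({}^{\circ}y,\beta_1,\ldots,\beta_n)$ lexicographically. $D_\infty:=\{x\in{}^{\bullet}\mathbb{R}:{}^{\circ}x=0\}$ is the set of infinitesimals. The Fermat extension of a smooth $f:\mathbb{R}\to\mathbb{R}$ is ${}^{\bullet}f:{}^{\bullet}\mathbb{R}\to{}^{\bullet}\mathbb{R}$, ${}^{\bullet}f([x])=[f\circ x]$. $\mathrm{sgn}$ is the sign function. *)

(* Defs.v *)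
From HB Require Import structures.
From mathcomp Require Import all_boot all_order all_algebra.
From mathcomp Require Import all_classical all_reals all_analysis.
From mathcomp Require Import generic_quotient ring_quotient ring lra.
Set Implicit Arguments. Unset Strict Implicit. Unset Printing Implicit Defensive.
Import Order.TTheory GRing.Theory Num.Theory.
Import numFieldNormedType.Exports.
Local Open Scope classical_set_scope.
Local Open Scope ring_scope.

Section FermatReals.
Variable R : realType.
Implicit Types (x y u v f g : R -> R) (r q t e C c : R).

Definition smooth f := forall n r, derivable (derive1n n f) r 1.

Definition pow_sum k (alpha a : 'I_k -> R) : R -> R :=
  fun t => \sum_(i < k) alpha i * t `^ a i.

(* A function [0, epsilon) -> R is represented by a total function R -> R:  *)
(* lo_poly and lo_eq only look at the value at 0 and at the germ at 0^+, so   *)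
(* the choice of epsilon and of the values outside [0, epsilon) is immaterial *)
(* and disappears in the quotient.                                            *)
Definition lo_poly : {pred R -> R} := fun x =>
  `[< exists k (alpha a : 'I_k -> R), (forall i, 0 < a i) /\
      (fun t => x t - (x 0 + pow_sum alpha a t)) =o_ (0^'+) id >].

Definition lo_eq x y := x 0 = y 0 /\ (fun t => x t - y t) =o_ (0^'+) id.

(* Closure of little-oh polynomials under the ring operations and under *)
(* composition with smooth functions. *)

Definition small u := forall e, 0 < e -> \forall t \near 0^'+, `|u t| <= e * t.

Lemma smallP u : u =o_ (0^'+) id <-> small u.
Proof.
split.
  move/eqoP => h e e0; have /= := h _ e0; apply: filterS2 (nbhs_right_gt 0) => t t0.
  by rewrite (gtr0_norm t0).
move=> h; apply/eqoP => e /= e0; have := h _ e0.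
apply: filterS2 (nbhs_right_gt 0) => t t0.
by rewrite (gtr0_norm t0).
Qed.

Lemma small_eq u v : (\forall t \near 0^'+, u t = v t) -> small u -> small v.
Proof. by move=> uv su e /su; apply: filterS2 uv => t ->. Qed.

Lemma smallD u v : small u -> small v -> small (fun t => u t + v t).
Proof.
move=> su sv e e0; have e2 : 0 < e / 2 by lra.
apply: filterS2 (su _ e2) (sv _ e2) => t ut vt.
by rewrite (le_trans (ler_normD _ _))//; lra.
Qed.

Lemma small_bndM C (b : R -> R) u : (\forall t \near 0^'+, `|b t| <= C) -> small u ->
  small (fun t => b t * u t).
Proof.
move=> bC su e e0; have C1 : 0 < `|C| + 1 by rewrite ltr_wpDl.
have e1 : 0 < e / (`|C| + 1) by rewrite divr_gt0.
apply: filterS2 bC (su _ e1) => t bt ut.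
rewrite normrM (le_trans (ler_pM _ _ (_ : _ <= `|C| + 1) ut))//.
  by rewrite (le_trans bt)// (le_trans (ler_norm C))// lerDl.
by rewrite mulrA mulrCA divff ?mulr1// gt_eqF.
Qed.

Lemma small0 : small (fun=> 0).
Proof.
move=> e e0; apply: filterS (nbhs_right_gt 0) => t t0.
by rewrite normr0 mulr_ge0 ?ltW.
Qed.

Lemma small_bnd C c u : 1 < c ->
  (\forall t \near 0^'+, `|u t| <= C * t `^ c) -> small u.
Proof.
move=> c1 uC.
have s1 : small (fun t => t `^ c).
  move=> e e0; have c0 : 0 < c - 1 by lra.
  have /cvgrPdist_le /(_ _ e0) := powR_cvg0 c0.
  apply: filterS2 (nbhs_right_gt 0) => t t0; rewrite sub0r normrN => h.
  rewrite -(mulr_powRB1 (ltW t0)); last lra.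
  by rewrite normrM (gtr0_norm t0) mulrC ler_wpM2r// ltW.
have sC : small (fun t => C * t `^ c).
  by apply: (@small_bndM `|C| (fun=> C)) s1; apply: nearW.
move=> e e0; apply: filterS2 (sC _ e0) uC => t h1 h2.
by rewrite (le_trans h2)// (le_trans _ h1)// ler_norm.
Qed.

Definition ps (s : seq (R * R)) t := \sum_(p <- s) p.1 * t `^ p.2.
Definition pos (s : seq (R * R)) := all (fun p : R * R => 0 < p.2) s.

Definition expands r x := exists2 s, pos s & small (fun t => x t - (r + ps s t)).

Lemma ps_bound s : pos s -> exists C c, [/\ 0 < c, c <= 1 &
  \forall t \near 0^'+, `|ps s t| <= C * t `^ c].
Proof.
elim: s => [_|[al a] s IH /= /andP[/= a0 ps0]].
  exists 0, 1; split => //; apply: nearW => t.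
  by rewrite /ps big_nil normr0 mul0r.
have [C [c [c0 c1 h]]] := IH ps0.
exists (`|al| + `|C|), (Num.min a c); split.
- by rewrite lt_min a0.
- by rewrite ge_min c1 orbT.
apply: filterS3 (nbhs_right_gt 0) (nbhs_right_le ltr01) h => t t0 t1 h.
rewrite /ps big_cons -/(ps s t) (le_trans (ler_normD _ _))// mulrDl lerD//.
  rewrite normrM ler_wpM2l// ger0_norm ?powR_ge0//=.
  by apply: ger_powR; rewrite ?t0// ge_min lexx.
apply: (le_trans h); apply: (@le_trans _ _ (`|C| * t `^ c)).
  by rewrite ler_wpM2r ?powR_ge0// ler_norm.
rewrite ler_wpM2l//.
by apply: ger_powR; rewrite ?t0// ge_min lexx orbT.
Qed.

Lemma expands_bound r x : expands r x -> exists C c, [/\ 0 < c, c <= 1 &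
  \forall t \near 0^'+, `|x t - r| <= C * t `^ c].
Proof.
move=> [s /ps_bound[C [c [c0 c1 h]]] /(_ _ ltr01) h1].
exists (C + 1), c; split => //.
apply: filterS3 (filterI (nbhs_right_gt 0) (nbhs_right_le ltr01)) h h1.
move=> t [t0 t1] h h1.
have -> : x t - r = ps s t + (x t - (r + ps s t)) by ring.
rewrite (le_trans (ler_normD _ _))// mulrDl lerD// (le_trans h1)//.
by rewrite !mul1r ger1_powR// t0.
Qed.

Lemma expands_cvg r x : expands r x -> x t @[t --> 0^'+] --> r.
Proof.
move=> /expands_bound[C [c [c0 c1 h]]].
apply/cvgrPdist_le => e e0.
have C1 : 0 < `|C| + 1 by rewrite ltr_wpDl.
have e1 : 0 < e / (`|C| + 1) by rewrite divr_gt0.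
have /cvgrPdist_le /(_ _ e1) := powR_cvg0 c0.
apply: filterS2 h => t h; rewrite sub0r normrN ger0_norm ?powR_ge0// => h1.
rewrite distrC (le_trans h)//.
apply: (@le_trans _ _ ((`|C| + 1) * t `^ c)).
  by rewrite ler_wpM2r ?powR_ge0// (le_trans (ler_norm C))// lerDl.
by rewrite -ler_pdivlMl// mulrC.
Qed.

Lemma expands_bnd r x : expands r x -> exists C, \forall t \near 0^'+, `|x t| <= C.
Proof.
move=> /expands_cvg /cvgrPdist_le /(_ _ ltr01) h; exists (`|r| + 1).
apply: filterS h => t h; rewrite -[x t](subrK r) addrC (le_trans (ler_normD _ _))//.
by rewrite lerD// distrC.
Qed.

Lemma expands_cst r : expands r (fun=> r).
Proof.
exists [::] => //; apply: small_eq small0; apply: nearW => t.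
by rewrite /ps big_nil; ring.
Qed.

Lemma expandsD r q x y : expands r x -> expands q y ->
  expands (r + q) (fun t => x t + y t).
Proof.
move=> [s ps1 h] [s' ps2 h']; exists (s ++ s'); first by rewrite /pos all_cat; apply/andP.
apply: small_eq (smallD h h'); apply: nearW => t.
by rewrite {3}/ps big_cat/= -/(ps s t) -/(ps s' t); ring.
Qed.

Lemma ps_scale k s : exists2 s', (pos s -> pos s') & forall t, ps s' t = k * ps s t.
Proof.
exists [seq (k * p.1, p.2) | p <- s]; first by rewrite /pos all_map.
by move=> t; rewrite /ps big_map mulr_sumr; apply: eq_bigr => p _ /=; rewrite mulrA.
Qed.

Lemma expandsM r q x y : expands r x -> expands q y ->
  expands (r * q) (fun t => x t * y t).
Proof.
move=> ex ey; have [C bx] := expands_bnd ex.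
have [C' by'] := expands_bnd ey.
case: ex ey => s ps1 h [s' ps2 h'].
have [s1 pos1 e1] := ps_scale q s.
have [s2 pos2 e2] := ps_scale r s'.
pose s3 := [seq (p.1 * p'.1, p.2 + p'.2) | p <- s, p' <- s'].
have pos3 : pos s3.
  apply/allP => _ /allpairsP[[p p'] /= [ips ips' ->]] /=.
  by rewrite addr_gt0 ?(allP ps1 _ ips) ?(allP ps2 _ ips').
exists (s1 ++ s2 ++ s3); first by rewrite /pos !all_cat; apply/and3P; split; auto.
have [D bps] : exists D, \forall t \near 0^'+, `|q + ps s' t| <= D.
  apply: (@expands_bnd q); exists s' => //; apply: small_eq small0.
  by apply: nearW => t; ring.
apply: small_eq (smallD (small_bndM bx h') (small_bndM bps h)).
apply: filterS (nbhs_right_gt 0) => t t0.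
have e3 : ps s3 t = ps s t * ps s' t.
  rewrite /ps big_allpairs_dep mulr_suml; apply: eq_bigr => p _.
  rewrite mulr_sumr; apply: eq_bigr => p' _ /=.
  by rewrite powRD ?(gt_eqF t0)//; [ring | rewrite implybT].
have -> : ps (s1 ++ s2 ++ s3) t = ps s1 t + (ps s2 t + ps s3 t).
  by rewrite /ps !big_cat.
by rewrite e1 e2 e3; ring.
Qed.

Lemma expands_poly (p : {poly R}) x : expands 0 x ->
  expands p.[0] (fun t => p.[x t]).
Proof.
move=> ex; elim/poly_ind: p => [|p k IH].
  have := expands_cst 0; rewrite horner0; congr expands.
  by apply/funext => t; rewrite horner0.
have := expandsD (expandsM IH ex) (expands_cst k).
rewrite mulr0 add0r; rewrite !hornerE ?mulr0 ?add0r; congr expands.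
by apply/funext => t; rewrite !hornerE.
Qed.

Lemma expands_small r x y : expands r x -> small (fun t => y t - x t) ->
  expands r y.
Proof.
move=> [s ps1 h] h'; exists s => //.
by apply: small_eq (smallD h h'); apply: nearW => t; ring.
Qed.

Lemma mvt_le g M (a b : R) : (forall z, derivable g z 1) ->
  (forall c, Num.min a b <= c <= Num.max a b -> `|g^`()%classic c| <= M) ->
  `|g a - g b| <= M * `|a - b|.
Proof.
move=> dg; wlog ab : a b / a < b => [hw h|h].
  case: (ltgtP a b) => [ab|ba|->]; last by rewrite !subrr normr0 mulr0.
    exact: hw.
  by rewrite distrC (distrC a) hw// minC maxC.
have dg' z : z \in `]a, b[%R -> is_derive z 1 g (g^`()%classic z).
  by move=> _; apply: DeriveDef; [exact: dg|rewrite derive1E].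
have cg : {within `[a, b], continuous g}.
  by apply: derivable_within_continuous => z _; exact: dg.
have [c] := MVT ab dg' cg; rewrite in_itv/= => /andP[ac cb] e.
rewrite distrC e normrM [`|a - b|]distrC ler_wpM2r// h//.
by rewrite (min_idPl (ltW ab)) (max_idPr (ltW ab)) !ltW.
Qed.

Lemma smooth_derive1 f : smooth f -> smooth (f^`()%classic).
Proof. by move=> sf n r; have := sf n.+1 r; rewrite derive1Sn. Qed.

Lemma smooth_derivable f : smooth f -> forall r, derivable f r 1.
Proof. by move=> sf r; exact: (sf 0%N). Qed.

Lemma smooth_bnd f r : smooth f -> exists K, \forall z \near r, `|f z| <= K.
Proof.
move=> /smooth_derivable /(_ r) /derivable1_diffP /differentiable_continuous.
move=> /cvgrPdist_le /(_ _ ltr01) h; exists (`|f r| + 1).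
apply: filterS h => t h; rewrite -[f t](subrK (f r)) addrC.
by rewrite (le_trans (ler_normD _ _))// lerD// distrC.
Qed.

Lemma between_ball r d a b c : ball r d a -> ball r d b ->
  Num.min a b <= c <= Num.max a b -> ball r d c.
Proof.
rewrite /ball/= !ltr_norml => /andP[? ?] /andP[? ?] /andP[].
by rewrite ge_min le_max => /orP[?|?] /orP[?|?]; apply/andP; split; lra.
Qed.

Lemma smooth_lip f r : smooth f -> exists K d, 0 < d /\
  forall a b, ball r d a -> ball r d b -> `|f a - f b| <= K * `|a - b|.
Proof.
move=> sf; have [K /nbhs_ballP[d /= d0 h]] := smooth_bnd r (smooth_derive1 sf).
exists K, d; split => // a b ra rb; apply: mvt_le; first exact: smooth_derivable.
by move=> c hc; apply: h; exact: between_ball hc.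
Qed.

Lemma prim (p : {poly R}) k : exists P : {poly R}, P^`() = p /\ P.[0] = k.
Proof.
exists (\poly_(i < (size p).+1) (if i == 0 then k else p`_i.-1 / i%:R)); split.
  apply/polyP => i; rewrite coef_deriv coef_poly ltnS.
  case: ltnP => [|h]/=; last by rewrite mul0rn nth_default.
  by rewrite -[LHS]mulr_natr divfK// pnatr_eq0.
by rewrite horner_coef0 coef_poly.
Qed.

Lemma is_derive_horner (p : {poly R}) (r z : R) :
  is_derive z 1 (fun w => p.[w - r]) (p^`().[z - r]).
Proof.
elim/poly_ind: p => [|p k IH].
  have -> : (fun w => (0 : {poly R}).[w - r]) = cst 0.
    by apply/funext => w; rewrite horner0.
  by rewrite deriv0 horner0; exact: is_derive_cst.
have -> : (fun w => (p * 'X + k%:P).[w - r]) =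
    (fun w => p.[w - r]) * (id - cst r) + cst k.
  by apply/funext => w; rewrite !hornerE.
apply: is_derive_eq.
by rewrite derivD derivM derivX derivC !hornerE !fctE /GRing.scale/=; ring.
Qed.

Lemma taylor N f r : smooth f -> exists (p : {poly R}) K,
  \forall z \near r, `|f z - p.[z - r]| <= K * `|z - r| ^+ N.
Proof.
elim: N f => [|N IH] f sf.
  have [K h] := smooth_bnd r sf; exists 0, K.
  by apply: filterS h => z; rewrite horner0 subr0 mulr1.
have [p [K /nbhs_ballP[d /= d0 h]]] := IH _ (smooth_derive1 sf).
have [P [dP P0]] := prim p (f r); exists P, `|K|.
apply/nbhs_ballP; exists d => //= z rz.
have rr : ball r d r by exact: ballxx.
pose g := f - (fun w => P.[w - r]).
have isd (w : R) : is_derive w 1 g (f^`()%classic w - p.[w - r]).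
  apply: is_deriveB; last by rewrite -dP; exact: is_derive_horner.
  by apply: DeriveDef; [exact: smooth_derivable|rewrite derive1E].
have := @mvt_le g (`|K| * `|z - r| ^+ N) z r (fun w => @ex_derive _ _ _ _ _ _ _ (isd w)).
have -> : g z - g r = f z - P.[z - r].
  by rewrite /g !fctE /= subrr P0; ring.
rewrite exprSr mulrA; apply => c hc.
rewrite derive1E (@derive_val _ _ _ _ _ _ _ (isd c)).
rewrite (le_trans (h c _))//; first exact: between_ball hc.
apply: (@le_trans _ _ (`|K| * `|c - r| ^+ N)).
  by rewrite ler_wpM2r ?exprn_ge0// ler_norm.
rewrite ler_wpM2l// lerXn2r ?nnegrE//.
case/andP: hc; rewrite ge_min le_max.
by case: (lerP r c) => rc; case: (lerP r z) => rz';
  rewrite ?(ger0_norm, ltr0_norm) ?subr_ge0 ?subr_lt0// => /orP[?|?] /orP[?|?]; lra.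
Qed.

Lemma expands_comp f r x : smooth f -> expands r x -> expands (f r) (f \o x).
Proof.
move=> sf ex; have [C [c [c0 c1 hb]]] := expands_bound ex.
have [N hN] : exists N : nat, 1 < c * N%:R.
  exists (Num.truncn c^-1).+1; rewrite -ltr_pdivrMl// mulr1.
  exact: truncnS_gt.
have N0 : (0 < N)%N.
  by case: N hN => //; rewrite mulr0 ltNge ler01.
have [p [K hp]] := taylor N r sf.
have p0 : p.[0] = f r.
  have := nbhs_singleton hp; rewrite subrr normr0 expr0n gtn_eqF// mulr0.
  by rewrite normr_le0 subr_eq0 => /eqP.
have e0 : expands 0 (fun t => x t - r).
  by have := expandsD ex (expands_cst (- r)); rewrite subrr.
have := expands_poly p e0; rewrite p0 => /expands_small; apply.
apply: (@small_bnd (`|K| * C ^+ N) (c * N%:R)) => //.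
have := expands_cvg ex; move=> /(_ _ hp) /= {}hp.
apply: filterS3 (nbhs_right_gt 0) hp hb => t t0 hp hb.
rewrite (le_trans hp)// powRrM powR_mulrn ?powR_ge0// -mulrA -exprMn.
apply: (@le_trans _ _ (`|K| * `|x t - r| ^+ N)).
  by rewrite ler_wpM2r ?exprn_ge0// ler_norm.
by rewrite ler_wpM2l// lerXn2r ?nnegrE// (le_trans _ hb).
Qed.

Lemma small_comp f r x y : smooth f -> expands r x -> expands r y ->
  small (fun t => x t - y t) -> small (fun t => f (x t) - f (y t)).
Proof.
move=> sf /expands_cvg ex /expands_cvg ey h.
have [K [d [d0 hK]]] := smooth_lip r sf.
have sK : small (fun t => `|K| * (x t - y t)).
  have KK : \forall t \near (0 : R)^'+, Num.norm `|K| <= `|K|.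
    by apply: nearW => t; rewrite normr_id.
  exact: small_bndM KK h.
move=> e e0; have sK1 := sK _ e0.
have bx : \forall t \near (0 : R)^'+, ball r d (x t) := (ex _ (nbhsx_ballx r d d0)).
have by' : \forall t \near (0 : R)^'+, ball r d (y t) := (ey _ (nbhsx_ballx r d d0)).
apply: filterS3 bx by' sK1 => t bx by' h1; rewrite (le_trans (hK _ _ bx by'))//.
by rewrite (le_trans _ h1)// normrM normr_id ler_wpM2r// ler_norm.
Qed.

Lemma lo_polyP x : reflect (expands (x 0) x) (x \in lo_poly).
Proof.
apply: (iffP (asboolP _)) => [[k [al [a [a0 /smallP h]]]]|[s ps0 h]].
  exists [seq (al i, a i) | i <- index_enum 'I_k].
    by apply/allP => _ /mapP[i _ ->] /=.
  by apply: small_eq h; apply: nearW => t; rewrite /ps big_map.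
exists (size s), (fun i => (nth 0 s i).1), (fun i => (nth 0 s i).2); split.
  by move=> i; apply: (allP ps0); exact: mem_nth.
apply/smallP; apply: small_eq h; apply: nearW => t; congr (_ - (_ + _)).
by rewrite /ps (big_nth 0) big_mkord.
Qed.

Lemma lo_poly_cst r : cst r \in lo_poly.
Proof. by apply/lo_polyP; exact: expands_cst. Qed.

Lemma lo_poly_subring : subring_closed lo_poly.
Proof.
split; first exact: lo_poly_cst.
  move=> x y /lo_polyP ex /lo_polyP ey; apply/lo_polyP.
  have := expandsD ex (expandsM (expands_cst (- 1)) ey).
  rewrite !fctE !mulN1r; congr expands.
  by apply/funext => t; rewrite mulN1r.
move=> x y /lo_polyP ex /lo_polyP ey; apply/lo_polyP.
exact: expandsM ex ey.
Qed.

HB.instance Definition _ :=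
  GRing.isSubringClosed.Build (R -> R) lo_poly lo_poly_subring.

Lemma lo_poly_comp f x : smooth f -> x \in lo_poly -> f \o x \in lo_poly.
Proof.
by move=> sf /lo_polyP ex; apply/lo_polyP; exact: expands_comp sf ex.
Qed.

Record little_oh := LittleOh { lo_fun :> R -> R; lo_funP : lo_fun \in lo_poly }.

HB.instance Definition _ := [isSub for lo_fun].
HB.instance Definition _ := [Choice of little_oh by <:].
HB.instance Definition _ := [SubChoice_isSubComNzRing of little_oh by <:].

Definition lo_null : {pred little_oh} := fun u : little_oh => `[< lo_eq u 0 >].

Lemma lo_null_idealr : idealr_closed lo_null.
Proof.
split.
- apply/asboolP; split => //; apply/smallP.
  by apply: small_eq small0; apply: nearW => t; rewrite subrr.
- by apply/asboolP => -[/eqP]; rewrite /= oner_eq0.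
- move=> a u v /asboolP[u0 /smallP hu] /asboolP[v0 /smallP hv].
  apply/asboolP; split.
    have -> : (a * u + v : little_oh) 0 = a 0 * u 0 + v 0 by [].
    by rewrite u0 v0 mulr0 addr0.
  have [C ba] := expands_bnd (elimT (lo_polyP _) (lo_funP a)).
  apply/smallP; apply: small_eq (smallD (small_bndM ba hu) hv).
  apply: nearW => t.
  have -> : (a * u + v : little_oh) t = a t * u t + v t by [].
  by rewrite -[(0 : R -> R) t]/(0 : R); ring.
Qed.

HB.instance Definition _ := isIdealr.Build little_oh lo_null lo_null_idealr.

Definition fermat := {ideal_quot lo_null}.
HB.instance Definition _ := GRing.ComNzRing.on fermat.
HB.instance Definition _ := EqQuotient.on fermat.

Local Open Scope quotient_scope.

Lemma fermat_eqP (x y : little_oh) :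
  \pi_fermat x = \pi_fermat y <-> lo_eq x y.
Proof.
have -> : (\pi_fermat x = \pi_fermat y) = (x - y \in lo_null).
  by rewrite propeqE (Quotient.idealrBE lo_null); split => /eqP.
split=> [/asboolP[h0 h1]|[h0 /smallP h1]].
  split; first by apply/eqP; rewrite -subr_eq0; apply/eqP.
  by apply/smallP; move/smallP: h1; apply: small_eq; apply: nearW => t; rewrite subr0.
apply/asboolP; split; first by rewrite -[LHS]/(x 0 - y 0) h0 subrr.
apply/smallP; apply: small_eq h1; apply: nearW => t.
by rewrite -[(x - y : little_oh) t]/(x t - y t) subr0.
Qed.

Lemma lo_eq_repr (x : little_oh) : lo_eq (repr (\pi_fermat x) : little_oh) x.
Proof. by apply/fermat_eqP; rewrite reprK. Qed.

(* The constants, i.e. the copy of R inside the Fermat reals. *)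
Definition fcst r : fermat := \pi_fermat (LittleOh (lo_poly_cst r)).

Definition st (x : fermat) : R := repr x 0.

Lemma st_pi (x : little_oh) : st (\pi_fermat x) = x 0.
Proof. by case: (lo_eq_repr x). Qed.

Definition fermat_ext f (sf : smooth f) (x : fermat) : fermat :=
  \pi_fermat (LittleOh (lo_poly_comp sf (lo_funP (repr x)))).

Lemma fermat_ext_pi f (sf : smooth f) (x : little_oh) :
  fermat_ext sf (\pi_fermat x) =
  \pi_fermat (LittleOh (lo_poly_comp sf (lo_funP x))).
Proof.
apply/fermat_eqP; have [h0 /smallP h1] := lo_eq_repr x.
split; rewrite /= ?h0//; apply/smallP.
apply: (small_comp sf _ _ h1); last exact: elimT (lo_polyP _) (lo_funP x).
by rewrite -h0; exact: elimT (lo_polyP _) (lo_funP _).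
Qed.

(* x = st x + sum_i alpha_i t^(a_i) in the quotient, where alpha_i = 0 is *)
(* allowed. *)
Definition quasi_decomposition (x : fermat) n (alpha a : 'I_n -> R) :=
  [/\ forall i, 0 < a i <= 1, {homo a : i j / (i < j)%N >-> i < j} &
      lo_eq (repr x) (fun t => st x + pow_sum alpha a t)].

Definition fle (x y : fermat) := exists n (a alpha beta : 'I_n -> R),
  [/\ quasi_decomposition x alpha a, quasi_decomposition y beta a &
      ((st x :: [seq alpha i | i : 'I_n] : seqlexi R) <=
       (st y :: [seq beta i | i : 'I_n] : seqlexi R))%O].

Definition Dinf : set fermat := [set h | st h = 0].

Definition Dinf_ge0 : set fermat := [set h | Dinf h /\ fle 0 h].

End FermatReals.

Arguments Dinf R : clear implicits.
Arguments Dinf_ge0 R : clear implicits.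

(* Main.v *)
(* If h is infinitesimal, then |h(t)| <= C t^c near 0+ for some c > 0, so a high
   enough power of h is o(t) and f(a + h) is computed by a Taylor polynomial.
   When all derivatives vanish at a, only f(a) is left.  Otherwise
   f(a + h) = f(a) + h^m q(h) with q(0) = f^(m)(a) / m!, and for even m the sign of
   f(z) - f(a) near a is that of f^(m)(a).  Conversely, a nonzero infinitesimal has
   a leading term, i.e. it is t^b k with k(0) <> 0 and b > 0; looking for
   h = t^(b/m) v, the equation h^m q(h) = t^b k becomes v^m q(t^(b/m) v) = k, whose
   solution v0 at t = 0 (a real m-th root) is simple and is lifted by Newton's
   iteration in the ring of little-oh polynomials. *)

From HB Require Import structures.
Require Import Defs.
From mathcomp Require Import all_boot all_order all_algebra.
From mathcomp Require Import all_classical all_reals all_analysis.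
From mathcomp Require Import generic_quotient ring lra.
Set Implicit Arguments. Unset Strict Implicit. Unset Printing Implicit Defensive.
Import Order.TTheory GRing.Theory Num.Theory.
Import numFieldNormedType.Exports.
Local Open Scope classical_set_scope.
Local Open Scope ring_scope.

(** * Newton's iteration over a commutative ring with a filtration *)

Section Newton.
Variable A : comNzRingType.
Implicit Types (G : {poly A}) (x v w d : A).

(** Taylor's formula to second order, valid in any commutative ring. The nested form also gives the
    congruence modulo [w], with the whole bracket as cofactor. *)
Lemma horner_addr G x w :
  exists r, G.[x + w] = G.[x] + w * (G^`().[x] + w * r).
Proof.
elim/poly_ind: G => [|G k [r IH]].
  by exists 0; rewrite deriv0 !horner0 !(mulr0, addr0).
exists (G^`().[x] + r * x + w * r).
by rewrite derivD derivM derivX derivC !hornerE IH; ring.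
Qed.

(* [I j] plays the role of the j-th power of an ideal in which [G.[v0]] and
   [G^`().[v0] - d] lie. *)
Variable I : nat -> A -> Prop.
Hypothesis I_add : forall j x y, I j x -> I j y -> I j (x + y).
Hypothesis I_mul : forall j x y, I j y -> I j (x * y).
Hypothesis I_mulS : forall j x y, I j x -> I 1 y -> I j.+1 (x * y).

(** The slope is frozen at [d], so only [d] has to be inverted; each step then gains one level of
    the filtration. *)
Lemma newton G v0 d d' : d' * d = 1 -> I 1 G.[v0] -> I 1 (G^`().[v0] - d) ->
  forall j, exists v, I j.+1 G.[v].
Proof.
move=> dd' G0 G1 j.
(* Keeping [w] in [I 1] keeps the derivative at [v0 + w] congruent to [d] throughout the
   iteration. *)
suff [w [] _ Gw] : exists w, I 1 w /\ I j.+1 G.[v0 + w] by exists (v0 + w).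
elim: j => [|j [w [Iw Gw]]].
  exists 0; rewrite addr0; split => //.
  by rewrite -(mul0r G.[v0]); exact: I_mul.
(* The family [I] is not assumed to be decreasing, so this comes from [G.[v0]] and not from [Gw]. *)
have Gw1 : I 1 G.[v0 + w].
  have [r ->] := horner_addr G v0 w; apply: I_add => //.
  by rewrite mulrC; exact: I_mul.
have dGw : I 1 (G^`().[v0 + w] - d).
  have [r ->] := horner_addr G^`() v0 w.
  rewrite addrAC; apply: I_add => //.
  by rewrite mulrC; exact: I_mul.
set g := G.[v0 + w] in Gw Gw1.
have Idg : I 1 (- d' * g) by exact: I_mul.
exists (w + - d' * g); split; first exact: I_add.
have [r] := horner_addr G (v0 + w) (- d' * g); rewrite -addrA -/g => ->.
(* Since [d' * d = 1], the correction cancels [g] up to the product of the correction with an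
   element of [I 1]. *)
have -> : g + - d' * g * (G^`().[v0 + w] + - d' * g * r) =
  - d' * g * ((G^`().[v0 + w] - d) + r * (- d' * g)) + (1 - d' * d) * g by ring.
rewrite dd' subrr mul0r addr0; apply: I_mulS; first exact: I_mul.
by apply: I_add => //; exact: I_mul.
Qed.

End Newton.

(** * The ring of little-oh polynomials and its filtration by order *)

Section LittleOhRing.
Variable R : realType.
Implicit Types (x y v : little_oh R) (b c r t : R).

(** Evaluation at [t] and the embedding of constants are registered as ring morphisms, so that
    polynomials over [little_oh R] can be evaluated pointwise. *)
Definition lo_eval t x : R := x t.

HB.instance Definition _ t := GRing.isZmodMorphism.Build (little_oh R) R
  (lo_eval t) (fun _ _ => erefl).
HB.instance Definition _ t := GRing.isMonoidMorphism.Build (little_oh R) R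
  (lo_eval t) (erefl, fun _ _ => erefl).

Definition lo_cst r : little_oh R := LittleOh (lo_poly_cst r).

Lemma lo_cst_zmod_morphism : zmod_morphism lo_cst.
Proof. by move=> x y; apply/val_inj. Qed.

Lemma lo_cst_monoid_morphism : monoid_morphism lo_cst.
Proof. by split => [|x y]; apply/val_inj. Qed.

HB.instance Definition _ := GRing.isZmodMorphism.Build R (little_oh R)
  lo_cst lo_cst_zmod_morphism.
HB.instance Definition _ := GRing.isMonoidMorphism.Build R (little_oh R)
  lo_cst lo_cst_monoid_morphism.

Lemma lo_eval_horner (q : {poly R}) x t :
  (map_poly lo_cst q).[x] t = q.[x t].
Proof.
rewrite -[LHS]/(lo_eval t _) -horner_map/= -map_poly_comp.
by congr _.[_]; apply: map_poly_id.
Qed.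

Lemma powR_lo_poly b : 0 < b -> (fun t => t `^ b) \in @lo_poly R.
Proof.
move=> b0; apply/lo_polyP; rewrite powR0 ?gt_eqF//; exists [:: (1, b)].
  by rewrite /pos/= b0.
apply: small_eq (@small0 R); apply: nearW => t.
by rewrite /ps big_seq1/=; ring.
Qed.

Lemma lo_expands x : expands (x 0) x.
Proof. exact: elimT (lo_polyP _) (lo_funP x). Qed.

(* Filtration by order of vanishing: roughly x = O(t^(c j)).  Powers of t^c are
   used instead of t^(c j) so that the filtration is multiplicative on the nose. *)
Definition lo_ideal c (j : nat) x :=
  exists C, \forall t \near 0^'+, `|x t| <= C * (t `^ c) ^+ j.

Lemma lo_idealD c j x y :
  lo_ideal c j x -> lo_ideal c j y -> lo_ideal c j (x + y).
Proof.
move=> [C hC] [D hD]; exists (C + D); apply: filterS2 hC hD => t hC hD.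
by rewrite (le_trans (ler_normD _ _))// mulrDl lerD.
Qed.

Lemma lo_idealMl c j x y : lo_ideal c j y -> lo_ideal c j (x * y).
Proof.
have [B hB] := expands_bnd (lo_expands x).
move=> [C hC]; exists (B * C); apply: filterS2 hB hC => t hB hC.
by rewrite [lo_fun _ _]/(x t * y t) normrM -mulrA ler_pM.
Qed.

Lemma lo_idealMS c j x y :
  lo_ideal c j x -> lo_ideal c 1 y -> lo_ideal c j.+1 (x * y).
Proof.
move=> [C hC] [D hD]; exists (C * D); apply: filterS2 hC hD => t hC hD.
rewrite [lo_fun _ _]/(x t * y t) normrM exprSr.
by rewrite mulrACA ler_pM.
Qed.

Lemma powR_lo_ideal b (b0 : 0 < b) c : c <= b ->
  lo_ideal c 1 (LittleOh (powR_lo_poly b0)).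
Proof.
move=> cb; exists 1.
apply: filterS2 (nbhs_right_gt 0) (nbhs_right_le (@ltr01 R)) => t t0 t1.
by rewrite mul1r expr1 ger0_norm ?powR_ge0// ger_powR ?t0.
Qed.

Lemma lo_idealW c c' x : c <= c' -> lo_ideal c' 1 x -> lo_ideal c 1 x.
Proof.
move=> cc [C h]; exists `|C|.
apply: filterS3 (nbhs_right_gt 0) (nbhs_right_le (@ltr01 R)) h => t t0 t1 h.
rewrite (le_trans h)//; apply: (@le_trans _ _ (`|C| * (t `^ c') ^+ 1)).
  by rewrite ler_wpM2r ?exprn_ge0 ?powR_ge0// ler_norm.
by rewrite ler_wpM2l// !expr1 ger_powR ?t0.
Qed.

(** Finitely many Newton steps thus solve an equation exactly in the quotient: once the order
    exceeds 1, the residue is [o(t)]. *)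
Lemma small_lo_ideal c j x : 1 < c * j%:R -> lo_ideal c j x -> small x.
Proof.
move=> cj [C h]; apply: (small_bnd (C := C) cj).
by apply: filterS h => t; rewrite powRrM powR_mulrn ?powR_ge0.
Qed.

Lemma exists_mulrn_gt1 c : 0 < c -> exists n, 1 < c * n.+1%:R.
Proof.
move=> c0; exists (Num.truncn c^-1).
by rewrite -ltr_pdivrMl// mulr1; exact: truncnS_gt.
Qed.

(* Substituting s v with s = t^(b/m) and dividing by t^b turns the equation into
   v^m q(s v) = k, which has the simple root v0 at t = 0. *)
Lemma solve_monomial (m : nat) (q : {poly R}) b (v0 : R) (k : little_oh R) :
  (0 < m)%N -> 0 < b -> v0 != 0 -> q.[0] != 0 -> q.[0] * v0 ^+ m = k 0 ->
  exists v, small (fun t =>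
    (t `^ (b / m%:R) * v t) ^+ m * q.[t `^ (b / m%:R) * v t] - t `^ b * k t).
Proof.
move=> m0 b0 v00 q0 qk; have m0' : 0 < m%:R :> R by rewrite ltr0n.
have bm0 : 0 < b / m%:R by rewrite divr_gt0.
have [C [c' [c0' _ kC]]] := expands_bound (lo_expands k).
(* With this [c], both [t^(b/m)] and [k - k(0)] lie in level 1 of the filtration. *)
pose c := Num.min (b / m%:R) c'.
have c0 : 0 < c by rewrite lt_min bm0.
have Ik : lo_ideal c 1 (k - lo_cst (k 0)).
  by apply: (@lo_idealW _ c'); [rewrite ge_min lexx orbT|exists C].
pose s := LittleOh (powR_lo_poly bm0).
have Is y : lo_ideal c 1 (y * s).
  by apply/lo_idealMl/powR_lo_ideal; rewrite ge_min lexx.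
pose Q := map_poly lo_cst q.
pose G := 'X^m * (Q \Po (s%:P * 'X)) - k%:P.
pose V := lo_cst v0; pose d := m%:R * v0 ^+ m.-1 * q.[0].
have d0 : d != 0 by rewrite !mulf_neq0 ?expf_neq0// gt_eqF.
(* Modulo [s], only the constant coefficient of [q] survives. This reduces [G] at [V] to the
   equation assumed for [v0], up to [k - k(0)], and its derivative to [d]. *)
have [z Qz] : exists z : little_oh R, Q.[s * V] = lo_cst q.[0] + z * s.
  have [r] := horner_addr Q 0 (s * V); rewrite add0r => ->.
  exists (V * (Q^`().[0] + s * V * r)).
  by rewrite -(rmorph0 lo_cst) horner_map; ring.
have GV : lo_ideal c 1 G.[V].
  have -> : G.[V] = V ^+ m * z * s + (- 1) * (k - lo_cst (k 0)).
    rewrite hornerD hornerN hornerC hornerM hornerXn horner_comp.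
    rewrite hornerM hornerC hornerX Qz.
    have -> : lo_cst (k 0) = lo_cst q.[0] * V ^+ m.
      by rewrite -qk rmorphM rmorphXn.
    by ring.
  by apply: lo_idealD => //; exact: lo_idealMl.
have GV' : lo_ideal c 1 (G^`().[V] - lo_cst d).
  have -> : G^`().[V] - lo_cst d =
      (m%:R * V ^+ m.-1 * z + V ^+ m * Q^`().[s * V]) * s; last exact: Is.
    rewrite /G derivB derivC subr0 derivM derivXn deriv_comp derivM derivX derivC.
    rewrite mul0r add0r mulr1 hornerD hornerM hornerMn hornerXn horner_comp.
    rewrite !hornerM hornerXn horner_comp hornerM !hornerC hornerX Qz -mulr_natl.
    have -> : lo_cst d = m%:R * V ^+ m.-1 * lo_cst q.[0].
      by rewrite !rmorphM rmorph_nat rmorphXn.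
    by ring.
have [j cj] := exists_mulrn_gt1 c0.
have dd : lo_cst d^-1 * lo_cst d = 1 by rewrite -rmorphM mulVf ?rmorph1.
have [v Gv] := newton (@lo_idealD c) (@lo_idealMl c) (@lo_idealMS c) dd GV GV' j.
(* Multiplication by [t^b] restores the original equation; being bounded, this factor preserves
   [o(t)]. *)
exists v; have bb : \forall t \near (0 : R)^'+, `|t `^ b| <= 1.
  apply: filterS2 (nbhs_right_gt 0) (nbhs_right_le (@ltr01 R)) => t t0 t1.
  by rewrite ger0_norm ?powR_ge0// -[leRHS](powRr0 t) ger_powR ?t0 ?(ltW b0).
have bG := small_bndM bb (small_lo_ideal cj Gv).
apply: small_eq bG; apply: nearW => t.
have -> : G.[v] t = v t ^+ m * q.[t `^ (b / m%:R) * v t] - k t.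
  rewrite hornerD hornerN hornerC hornerM hornerXn horner_comp.
  rewrite hornerM hornerC hornerX -[LHS]/(lo_eval t _) rmorphB rmorphM rmorphXn.
  by rewrite [X in _ * X - _]lo_eval_horner.
rewrite mulrBr mulrA exprMn; congr (_ * _ * _ - _).
by rewrite -powR_mulrn ?powR_ge0// -powRrM divfK// gt_eqF.
Qed.

End LittleOhRing.

(** * Taylor expansion with a prescribed polynomial *)

Section Taylor.
Variable R : realType.
Implicit Types (f g : R -> R) (p q : {poly R}) (r z : R).

Lemma is_derive_horner_subr f p r z : smooth f ->
  is_derive z 1 (f - (fun w => p.[w - r]))
    (f^`()%classic z - p^`().[z - r]).
Proof.
move=> sf; apply: is_deriveB; last exact: is_derive_horner.
by apply: DeriveDef; [exact: smooth_derivable|rewrite derive1E].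
Qed.

(** Induction on [N] for all [f] and [p]: the bound for the derivatives passes to [f z - p.[z - r]]
    by the mean value inequality, which adds one power because this difference vanishes at [r]. *)
Lemma taylor_near N f p r : smooth f ->
  (forall i, (i < N)%N -> derive1n i f r = p^`(i).[0]) ->
  exists K, \forall z \near r, `|f z - p.[z - r]| <= K * `|z - r| ^+ N.
Proof.
elim: N f p => [|N IH] f p sf fp; pose g := f - (fun w => p.[w - r]).
  have /@ex_derive/derivable1_diffP/differentiable_continuous :=
    is_derive_horner_subr p r r sf.
  move=> /cvgrPdist_le /(_ _ ltr01) h; exists (`|g r| + 1).
  apply: filterS h => z h; rewrite mulr1 -[f z - _]/(g z) -[g z](subrK (g r)).
  by rewrite addrC (le_trans (ler_normD _ _))// lerD// distrC.
have [i iN|K /nbhs_ballP[e /= e0 h]] := IH _ p^`() (smooth_derive1 sf).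
  by rewrite -derivSn -fp // derive1Sn.
exists `|K|; apply/nbhs_ballP; exists e => //= z rz.
have := @mvt_le R g (`|K| * `|z - r| ^+ N) z r
  (fun w => @ex_derive _ _ _ _ _ _ _ (is_derive_horner_subr p r w sf)).
have fr : f r = p.[0] by have := fp 0%N isT.
have -> : g z - g r = f z - p.[z - r] by rewrite /g !fctE /= subrr fr; ring.
rewrite exprSr mulrA; apply => c hc.
rewrite derive1E (@derive_val _ _ _ _ _ _ _ (is_derive_horner_subr p r c sf)).
rewrite (le_trans (h c (between_ball rz (ballxx r e0) hc)))//.
apply: (@le_trans _ _ (`|K| * `|c - r| ^+ N)).
  by rewrite ler_wpM2r ?exprn_ge0// ler_norm.
rewrite ler_wpM2l// lerXn2r ?nnegrE// ler_norml; move: hc.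
case: (lerP z r) => zr; rewrite ?(min_idPl zr, max_idPr zr) => /andP[? ?].
  by apply/andP; split; lra.
by apply/andP; split; lra.
Qed.

Lemma horner0_derivn p i : p^`(i).[0] = p`_i * i`!%:R.
Proof. by rewrite horner_coef0 coef_derivn addn0 ffactnn mulr_natr. Qed.

(** The Taylor polynomial in [z - r], stripped of its terms below degree [m] and divided by the
    [m]-th power; for [0 < N] its value at 0 is the [m]-th Taylor coefficient. *)
Definition taylor_tail f r m N : {poly R} :=
  \poly_(i < N) (derive1n (m + i) f r / (m + i)`!%:R).

Lemma taylor_order N f r m : smooth f -> (0 < m)%N ->
  (forall i, (0 < i < m)%N -> derive1n i f r = 0) ->
  exists K, \forall z \near r,
    `|f z - (f r + (z - r) ^+ m * (taylor_tail f r m N).[z - r])| <=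
    K * `|z - r| ^+ (m + N).
Proof.
move=> sf m0 f0.
have [i|K h] := @taylor_near (m + N) f
  ((f r)%:P + 'X^m * taylor_tail f r m N) r sf.
  move=> imN; rewrite horner0_derivn coefD coefC coefXnM.
  have i0 : i`!%:R != 0 :> R by rewrite pnatr_eq0 -lt0n fact_gt0.
  case: ltnP => im; case: eqVneq => [i00|in0].
  - by rewrite i00 derive1n0 addr0 fact0 mulr1.
  - by rewrite addr0 mul0r f0// lt0n in0.
  - by move: im; rewrite i00 leqNgt m0.
  - by rewrite add0r coef_poly ltn_subLR// imN subnKC// divfK.
by exists K; apply: filterS h => z; rewrite !hornerE.
Qed.

End Taylor.

(** * Leading terms of infinitesimals and the order *)

Section LeadingTerm.
Variable R : realType.
Implicit Types (s : seq (R * R)) (t b c : R) (h : fermat R).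

Local Notation zero_coefs := (all (fun p : R * R => p.1 == 0)).

(** Zero coefficients are allowed, as in a quasi-decomposition. *)
Definition increasing s := sorted <%R [seq p.2 | p <- s] /\
  forall p, p \in s -> 0 < p.2 <= 1.

Lemma small_ps_gt1 s : small (fun t => \sum_(p <- s | ~~ (p.2 <= 1)) p.1 * t `^ p.2).
Proof.
elim: s => [|p s IH].
  by apply: small_eq (@small0 R); apply: nearW => t; rewrite big_nil.
case p1 : (p.2 <= 1).
  by apply: small_eq IH; apply: nearW => t; rewrite big_cons p1.
have sp : small (fun t => p.1 * t `^ p.2).
  apply: (@small_bnd _ `|p.1| p.2); first by rewrite ltNge p1.
  by apply: nearW => t; rewrite normrM (ger0_norm (powR_ge0 _ _)).
by apply: small_eq (smallD sp IH); apply: nearW => t; rewrite big_cons p1.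
Qed.

(** Coefficients of equal exponents are added up, the exponents are sorted, and terms with exponent
    above 1 go into [o(t)]. *)
Lemma increasing_ps s : pos s ->
  exists2 s', increasing s' & small (fun t => ps s t - ps s' t).
Proof.
move=> ps0; pose E := sort <=%R (undup [seq p.2 | p <- s & p.2 <= 1]).
have Euniq : uniq E by rewrite sort_uniq undup_uniq.
have inE p : p \in s -> (p.2 \in E) = (p.2 <= 1).
  move=> ips; rewrite mem_sort mem_undup; apply/mapP/idP => [[p']|p1].
    by rewrite mem_filter => /andP[? _] ->.
  by exists p => //; rewrite mem_filter p1.
exists [seq (\sum_(p <- s | p.2 == e) p.1, e) | e <- E].
  split; first by rewrite -map_comp map_id lt_sorted_uniq_le Euniq sort_le_sorted.
  move=> _ /mapP[e + ->] /=; rewrite mem_sort mem_undup => /mapP[p].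
  by rewrite mem_filter => /andP[p1 /(allP ps0) p0] ->; rewrite p0.
apply: small_eq (small_ps_gt1 s); apply: nearW => t.
suff -> : ps [seq (\sum_(p <- s | p.2 == e) p.1, e) | e <- E] t =
    \sum_(p <- s | p.2 <= 1) p.1 * t `^ p.2.
  by rewrite /ps [X in _ = X - _](bigID (fun p => p.2 <= 1))/= addrAC subrr add0r.
(* After exchanging the sums, each term of [s] meets exactly one exponent of [E], or none if its
   exponent exceeds 1. *)
rewrite /ps big_map/=; under eq_bigr do rewrite mulr_suml big_mkcond.
rewrite exchange_big/= [RHS]big_mkcond big_seq [RHS]big_seq.
apply: eq_bigr => p ips; rewrite -(inE p ips).
case: ifPn => pE; last first.
  by rewrite big_seq big1// => e eE; case: eqP => // pe; rewrite pe eE in pE.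
rewrite (bigD1_seq p.2)//= eqxx big1 ?addr0// => e /negPf ep.
by rewrite eq_sym ep.
Qed.

Lemma increasing_lead s : increasing s -> zero_coefs s \/
  exists s1 c b s2, [/\ s = s1 ++ (c, b) :: s2, zero_coefs s1, c != 0,
    0 < b <= 1 & forall p, p \in s2 -> b < p.2].
Proof.
elim: s => [|[c b] s IH] [/= srt s01]; first by left.
have b01 := s01 _ (mem_head _ _).
have [->|c0] := eqVneq c 0; last first.
  right; exists [::], c, b, s; split => // p ps'.
  have /allP := order_path_min lt_trans srt; apply.
  exact: map_f.
have [|?|[s1 [c' [b' [s2 [-> s10 c'0 b'01 s2b]]]]]] := IH.
- by split => [|p ps']; [exact: path_sorted srt|apply: s01; rewrite inE ps' orbT].
- by left.
- right; exists ((0, b) :: s1), c', b', s2; split => //=.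
  by rewrite eqxx.
Qed.

Lemma ps_eq0 s t : zero_coefs s -> ps s t = 0.
Proof.
by move=> /allP s0; rewrite /ps big_seq big1// => p /s0 /eqP ->; rewrite mul0r.
Qed.

(** The strict inequality leaves positive exponents after division by [t^b], so the quotient is a
    little-oh polynomial with value [c] at 0. *)
Lemma ps_factor s c b : (forall p, p \in s -> b < p.2) ->
  exists2 k : little_oh R, k 0 = c &
    forall t, 0 < t -> ps ((c, b) :: s) t = t `^ b * k t.
Proof.
move=> sb; pose s' := [seq (p.1, p.2 - b) | p <- s].
have ps' : pos s' by apply/allP => _ /mapP[p /sb ? ->] /=; rewrite subr_gt0.
have ps'0 : ps s' 0 = 0.
  rewrite /ps big_map big_seq big1// => p /sb bp /=.
  by rewrite powR0 ?mulr0// gt_eqF// subr_gt0.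
have kP : (fun t => c + ps s' t) \in @lo_poly R.
  apply/lo_polyP; rewrite ps'0 addr0; exists s' => //.
  by apply: small_eq (@small0 R); apply: nearW => t; rewrite subrr.
exists (LittleOh kP) => [|t t0] /=; first by rewrite ps'0 addr0.
rewrite /ps big_cons/= big_map mulrDr mulrC; congr (_ + _).
rewrite mulr_sumr; apply: eq_bigr => p _ /=.
by rewrite mulrCA -powRD ?(gt_eqF t0) ?implybT// addrC subrK.
Qed.

(** As [b <= 1], [t^b] dominates any [o(t)] error; if [k 0] were negative, [x t] would be at most a
    negative multiple of [t^b]. *)
Lemma lead_coef_ge0 (x k : little_oh R) b : 0 < b <= 1 ->
  (\forall t \near 0^'+, 0 <= x t) -> small (fun t => x t - t `^ b * k t) ->
  0 <= k 0.
Proof.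
move=> /andP[b0 b1] x0 sm; rewrite leNgt; apply/negP => k0.
pose e := - k 0 / 2; have e0 : 0 < e by rewrite /e; lra.
have /cvgrPdist_le /(_ _ e0) hk := expands_cvg (lo_expands k).
have e20 : 0 < e / 2 by lra.
near (0 : R)^'+ => t.
have t0 : 0 < t by near: t; exact: nbhs_right_gt.
have t1 : t <= 1 by near: t; exact: nbhs_right_le.
have xt : 0 <= x t by near: t.
have : `|k 0 - k t| <= e by near: t.
have : `|x t - t `^ b * k t| <= e / 2 * t by near: t; exact: sm.
rewrite !ler_norml => /andP[_ h1] /andP[h2 _].
have tb : t <= t `^ b by rewrite ger1_powR ?t0.
have kt : k t <= - e by rewrite /e; rewrite /e in h2; lra.
by move: k0 h2 => _ _; nra.
Unshelve. all: by end_near.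
Qed.

Lemma lead_coef_eq0 (k : little_oh R) b : 0 < b <= 1 ->
  small (fun t => t `^ b * k t) -> k 0 = 0.
Proof.
move=> b01 sm; apply/le_anti/andP; split.
  rewrite -oppr_ge0; apply: (@lead_coef_ge0 0 (- k) b) => //; first exact: nearW.
  apply: small_eq sm; apply: nearW => t.
  by rewrite -[(- k) t]/(- k t) -[(0 : little_oh R) t]/(0 : R); ring.
have one t : `|(- 1 : R)| <= 1 by rewrite normrN normr1.
apply: (@lead_coef_ge0 0 k b) => //; first exact: nearW.
apply: small_eq (small_bndM (nearW _ one) sm); apply: nearW => t.
by rewrite -[(0 : little_oh R) t]/(0 : R); ring.
Qed.

Lemma lexi_zero_lead (u w : seq R) c : all (fun r => r == 0) u -> c != 0 ->
  ((nseq (size (u ++ c :: w)) 0 : seqlexi R) <= (u ++ c :: w : seqlexi R))%O =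
  (0 < c).
Proof.
move=> + c0; elim: u => [_|r u IH /= /andP[/eqP -> /IH]] /=.
  by rewrite lexi_cons lt_neqAle eq_sym c0/=; case: ltgtP c0.
by rewrite lexi_cons lexx.
Qed.

Lemma all_eq0_nseq (u : seq R) : all (fun r => r == 0) u -> u = nseq (size u) 0.
Proof. by move=> /all_pred1P. Qed.

Local Open Scope quotient_scope.

(** List form of a quasi-decomposition; the standard part is left out because only infinitesimals
    are decomposed this way. *)
Definition decomposes h s := increasing s /\ small (fun t => repr h t - ps s t).

Lemma decomposes_exists h : Dinf R h -> exists s, decomposes h s.
Proof.
rewrite /Dinf/= /st => h0; have := lo_expands (repr h); rewrite h0.
move=> [s /increasing_ps[s' incs' ss'] hs]; exists s'; split => //.
by apply: small_eq (smallD hs ss'); apply: nearW => t; ring.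
Qed.

Lemma decomposes_quasi h n (alpha a : 'I_n -> R) : Dinf R h ->
  quasi_decomposition h alpha a ->
  decomposes h [seq (alpha i, a i) | i : 'I_n].
Proof.
move=> h0 [a01 amono [_ /smallP sm]]; split; last first.
  apply: small_eq sm; apply: nearW => t.
  by rewrite h0 add0r /ps big_image.
split; last by move=> _ /mapP[i _ ->] /=.
rewrite -map_comp; apply: (@homo_sorted _ _ _ (relpre val ltn)).
  by move=> i j; exact: amono.
by rewrite -sorted_map val_enum_ord iota_ltn_sorted.
Qed.

Lemma quasi_decomposes h s : Dinf R h -> decomposes h s ->
  quasi_decomposition h (fun i : 'I_(size s) => (tnth (in_tuple s) i).1)
    (fun i => (tnth (in_tuple s) i).2).
Proof.
move=> h0 [[srt s01] sm]; split.
- by move=> i; apply: s01; exact: mem_tnth.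
- have aE (i : 'I_(size s)) :
      (tnth (in_tuple s) i).2 = nth 0 [seq p.2 | p <- s] i.
    by rewrite (nth_map 0)// (tnth_nth 0).
  move=> i j ij; rewrite !aE.
  by rewrite (lt_sorted_ltn_nth 0 srt) ?inE ?size_map.
- split.
    rewrite -/(st h) h0 add0r /pow_sum big1// => i _.
    have /andP[a0 _] := s01 _ (mem_tnth i (in_tuple s)).
    by rewrite powR0 ?mulr0// gt_eqF.
  apply/smallP; apply: small_eq sm; apply: nearW => t.
  by rewrite h0 add0r /ps /pow_sum (big_tnth _ _ s).
Qed.

(** The first nonzero coefficient gives both the factorization and, through the lexicographic order,
    the sign of [h]. The zero list has the length of [s] because [fle] compares over common
    exponents. *)
Lemma decomposes_lead h s : Dinf R h -> decomposes h s ->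
  (zero_coefs s /\ h = 0) \/
  exists b (b0 : 0 < b) (k : little_oh R),
    [/\ h = \pi_(fermat R) (LittleOh (powR_lo_poly b0) * k), k 0 != 0, b <= 1 &
    ((nseq (size s) 0 : seqlexi R) <= ([seq p.1 | p <- s] : seqlexi R))%O =
      (0 < k 0)].
Proof.
move=> h0 [incs sm]; have [s0|] := increasing_lead incs.
  left; split => //; rewrite -[h]reprK -(rmorph0 (\pi_(fermat R))).
  apply/fermat_eqP; split => //; apply/smallP.
  apply: small_eq sm; apply: nearW => t.
  by rewrite ps_eq0 // -[(0 : little_oh R) t]/(0 : R).
move=> [s1 [c [b [s2 [sE s10 c0 /andP[b0 b1] s2b]]]]].
have [k k0 hk] := ps_factor c s2b; right; exists b, b0, k; split => //.
- rewrite -[LHS]reprK; apply/fermat_eqP; split.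
    rewrite -[LHS]/(st h) h0.
    by rewrite -[RHS]/(0 `^ b * k 0) powR0 ?gt_eqF ?mul0r.
  apply/smallP; apply: small_eq sm; apply: filterS (nbhs_right_gt 0) => t t0.
  have -> : ps s t = ps ((c, b) :: s2) t.
    by rewrite sE {1}/ps big_cat/= -/(ps _ _) (ps_eq0 _ s10) add0r.
  by rewrite hk.
- by rewrite k0.
- rewrite sE map_cat/= -(size_map fst) map_cat/= lexi_zero_lead ?k0//.
  by rewrite all_map.
Qed.

Lemma Dinf_lead h : Dinf R h -> h = 0 \/
  exists b (b0 : 0 < b) (k : little_oh R), k 0 != 0 /\
    h = \pi_(fermat R) (LittleOh (powR_lo_poly b0) * k).
Proof.
move=> h0; have [s /(decomposes_lead h0)[[_ ->]|]] := decomposes_exists h0.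
  by left.
by move=> [b [b0 [k [hk k0 _ _]]]]; right; exists b, b0, k.
Qed.

Lemma Dinf0 : Dinf R 0.
Proof. by rewrite /Dinf/= -(rmorph0 (\pi_(fermat R))) st_pi. Qed.

(** [fle] supplies an arbitrary quasi-decomposition of 0; a nonzero leading coefficient in it would
    contradict [lead_coef_eq0]. *)
Lemma decomposes0 s : decomposes 0 s -> zero_coefs s.
Proof.
move=> /(decomposes_lead Dinf0)[[]//|[b [b0 [k [e /eqP k0 b1 _]]]]].
case: k0; apply: (@lead_coef_eq0 k b); first by rewrite b0.
move: e; rewrite -(rmorph0 (\pi_(fermat R))) => /esym/fermat_eqP[_ /smallP].
apply: small_eq; apply: nearW => t; rewrite -[(0 : little_oh R) t]/(0 : R).
by rewrite subr0.
Qed.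

Lemma Dinf_ge0_lead h : Dinf_ge0 R h -> h = 0 \/
  exists b (b0 : 0 < b) (k : little_oh R), 0 < k 0 /\
    h = \pi_(fermat R) (LittleOh (powR_lo_poly b0) * k).
Proof.
move=> [h0 [n [a [alpha [beta [q0 qh lx]]]]]].
have [[_ ->]|[b [b0 [k [hk _ _ lxk]]]]] :=
  decomposes_lead h0 (decomposes_quasi h0 qh); first by left.
right; exists b, b0, k; split => //; rewrite -lxk.
have /all_eq0_nseq al0 : all (fun r => r == 0) [seq alpha i | i : 'I_n].
  have := decomposes0 (decomposes_quasi Dinf0 q0).
  by rewrite !all_map.
move: lx; rewrite h0 Dinf0 lexi_cons lexx/= al0 -map_comp.
by rewrite !size_map.
Qed.

(** The order is defined by coefficients; pointwise nonnegativity reaches it through the sign of the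
    leading one. For the comparison, 0 gets zero coefficients on the exponents found for [x]. *)
Lemma Dinf_ge0_near (x : little_oh R) : x 0 = 0 ->
  (\forall t \near 0^'+, 0 <= x t) -> Dinf_ge0 R (\pi_(fermat R) x).
Proof.
move=> x0 xge0; have h0 : Dinf R (\pi_(fermat R) x) by rewrite /Dinf/= st_pi.
split => //; have [s ds] := decomposes_exists h0.
have qs := quasi_decomposes h0 ds; set a := fun i => _.2 in qs.
exists (size s), a, (fun=> 0), (fun i => (tnth (in_tuple s) i).1); split => //.
  case: qs => a01 amono _; split => //; split.
    by rewrite -/(st 0) /pow_sum big1 ?addr0// => i _; rewrite mul0r.
  (* The representative chosen for 0 is only known to be equivalent to the zero function. *)
  have [_ /smallP] := lo_eq_repr (0 : little_oh R).
  rewrite (rmorph0 (\pi_(fermat R))) => sm; apply/smallP; apply: small_eq sm.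
  apply: nearW => t; rewrite Dinf0 add0r /pow_sum big1// => i _.
  by rewrite mul0r.
rewrite h0 Dinf0 lexi_cons lexx/=.
have -> : [seq (tnth (in_tuple s) i).1 | i : 'I_(size s)] = [seq p.1 | p <- s].
  have sE : s = [seq tnth (in_tuple s) i | i <- enum 'I_(size s)].
    by rewrite (map_tnth_enum (in_tuple s)).
  by rewrite [in RHS]sE -map_comp.
have -> : [seq (0 : R) | i : 'I_(size s)] = nseq (size s) 0.
  have := @all_eq0_nseq [seq (0 : R) | i : 'I_(size s)].
  rewrite size_image card_ord; apply.
  by rewrite all_map; apply/allP => i _ /=; exact: eqxx.
have [[s0 _]|[b [b0 [k [hk k0 b1 ->]]]]] := decomposes_lead h0 ds.
  by rewrite [X in (_ <= X)%O]all_eq0_nseq ?all_map// size_map.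
rewrite lt_neqAle eq_sym k0/=; apply: (@lead_coef_ge0 x k b) => //; first by rewrite b0.
move/fermat_eqP: hk => [_ /smallP]; exact.
Qed.

End LeadingTerm.

(** * Real roots of order [m] *)

Section Roots.
Variable R : realType.
Implicit Types (m : nat) (y : R).

Lemma exists_root m y : (0 < m)%N -> 0 < y -> exists2 v, 0 < v & v ^+ m = y.
Proof.
move=> m0 y0; exists (y `^ m%:R^-1); first exact: powR_gt0.
by rewrite -powR_mulrn ?powR_ge0// -powRrM mulVf ?powRr1 ?ltW// gt_eqF ?ltr0n.
Qed.

Lemma exists_odd_root m y : odd m -> y != 0 -> exists2 v, v != 0 & v ^+ m = y.
Proof.
move=> om; have m0 := odd_gt0 om.
rewrite neq_lt => /orP[|] y0; last first.
  by have [v v0 <-] := exists_root m0 y0; exists v => //; rewrite gt_eqF.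
have [|v v0 vy] := @exists_root m (- y) m0; first by rewrite oppr_gt0.
exists (- v); first by rewrite oppr_eq0 gt_eqF.
by rewrite exprNn -signr_odd om expr1 mulN1r vy opprK.
Qed.

End Roots.

(** * The image of the infinitesimal neighbourhood of [a] *)

Section Image.
Variables (R : realType) (f : R -> R) (sf : smooth f) (a : R).
Implicit Types (x y k : little_oh R) (b c : R) (m n N : nat).

Local Open Scope quotient_scope.
Local Notation pi := (\pi_(fermat R)).

Lemma fcst_addDinf : [set fcst a + h | h in Dinf R] = [set x | st x = a].
Proof.
apply/seteqP; split => [_ [h h0 <-]|x xa] /=.
  rewrite -[h]reprK -[fcst a]/(pi (lo_cst a)) -rmorphD st_pi.
  have h0' : repr h 0 = 0 := h0.
  by rewrite -[LHS]/(a + repr h 0) h0' addr0.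
exists (x - fcst a); last by rewrite addrC subrK.
rewrite /Dinf/= -[x]reprK -[fcst a]/(pi (lo_cst a)) -rmorphB st_pi.
by rewrite -[LHS]/(st x - a) xa subrr.
Qed.

Lemma fermat_ext_eq x y : x 0 = a -> y 0 = f a ->
  small (fun t => f (x t) - y t) -> fermat_ext sf (pi x) = pi y.
Proof.
move=> xa ya sm; rewrite fermat_ext_pi; apply/fermat_eqP; split => /=.
  by rewrite xa.
exact/smallP.
Qed.

Lemma st_fermat_ext x : x 0 = a -> st (fermat_ext sf (pi x)) = f a.
Proof. by move=> xa; rewrite fermat_ext_pi st_pi /= xa. Qed.

(** As [x - a] is [O(t^c)], an error of order [n] in [x - a] is [O(t^(c n))], hence [o(t)]. *)
Lemma small_near_comp (p : R -> R) c K n x : x 0 = a ->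
  lo_ideal c 1 (x - lo_cst a) -> 1 < c * n%:R ->
  (\forall z \near a, `|f z - p z| <= K * `|z - a| ^+ n) ->
  small (fun t => f (x t) - p (x t)).
Proof.
move=> xa [C hC] cn hK; apply: (@small_bnd _ (`|K| * C ^+ n) (c * n%:R)) => //.
have := expands_cvg (lo_expands x); rewrite xa => /(_ _ hK) /= {}hK.
apply: filterS2 hC hK => t hC /le_trans; apply.
rewrite powRrM powR_mulrn ?powR_ge0// -mulrA -exprMn.
apply: (@le_trans _ _ (`|K| * `|x t - a| ^+ n)).
  by rewrite ler_wpM2r ?exprn_ge0// ler_norm.
rewrite expr1 in hC.
by rewrite ler_wpM2l// lerXn2r ?nnegrE// (le_trans _ hC).
Qed.

Lemma lo_ideal_sub_st x : exists2 c, 0 < c & lo_ideal c 1 (x - lo_cst (x 0)).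
Proof.
have [C [c [c0 _ h]]] := expands_bound (lo_expands x).
by exists c => //; exists C.
Qed.

Lemma fermat_ext_flat x : (forall n, (0 < n)%N -> derive1n n f a = 0) ->
  x 0 = a -> fermat_ext sf (pi x) = fcst (f a).
Proof.
move=> f0 xa; apply: (@fermat_ext_eq x (lo_cst (f a))) => //.
have [c c0 Ix] := lo_ideal_sub_st x; rewrite xa in Ix.
have [n cn] := exists_mulrn_gt1 c0.
have [i _|K hK] := @taylor_near R n.+1 f (f a)%:P a sf.
  rewrite horner0_derivn coefC; case: eqVneq => [->|i0].
    by rewrite derive1n0 mulr1.
  by rewrite mul0r f0// lt0n.
apply: (@small_near_comp (fun=> f a) c K n.+1) => //.
by apply: filterS hK => z; rewrite hornerC.
Qed.

Lemma fermat_ext_cst : fermat_ext sf (fcst a) = fcst (f a).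
Proof. by rewrite fermat_ext_pi; congr (pi _); apply/val_inj. Qed.

Section FirstNonzeroDerivative.
Variable m : nat.
Hypothesis m_gt0 : (0 < m)%N.
Hypothesis fm_neq0 : derive1n m f a != 0.
Hypothesis f_eq0 : forall i, (0 < i < m)%N -> derive1n i f a = 0.

(** Provides preimages in both parities, which differ only in how the real root [v0] is obtained. *)
Lemma fermat_ext_monomial b (b0 : 0 < b) k (v0 : R) : v0 != 0 ->
  derive1n m f a / m`!%:R * v0 ^+ m = k 0 ->
  exists2 x : little_oh R, x 0 = a & fermat_ext sf (pi x) =
    fcst (f a) + pi (LittleOh (powR_lo_poly b0) * k).
Proof.
move=> v00 vk; have bm0 : 0 < b / m%:R by rewrite divr_gt0// ltr0n.
have [n bn] := exists_mulrn_gt1 bm0.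
have [K hK] := taylor_order n.+1 sf m_gt0 f_eq0.
set q := taylor_tail _ _ _ _ in hK.
have q0 : q.[0] = derive1n m f a / m`!%:R by rewrite horner_coef0 coef_poly addn0.
have q_neq0 : q.[0] != 0.
  by rewrite q0 mulf_neq0// invr_eq0 pnatr_eq0 -lt0n fact_gt0.
have vk' : q.[0] * v0 ^+ m = k 0 by rewrite q0.
have [v hv] := solve_monomial m_gt0 b0 v00 q_neq0 vk'.
pose s := LittleOh (powR_lo_poly bm0); pose x := lo_cst a + v * s.
have xE t : x t - a = t `^ (b / m%:R) * v t.
  by rewrite -[x t]/(a + v t * t `^ (b / m%:R)); ring.
have xa : x 0 = a.
  by apply/eqP; rewrite -subr_eq0 xE powR0 ?mul0r// gt_eqF.
exists x => //; rewrite -[fcst (f a)]/(pi (lo_cst (f a))) -rmorphD.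
apply: fermat_ext_eq => //.
  rewrite -[LHS]/(f a + 0 `^ b * k 0).
  by rewrite powR0 ?mul0r ?addr0// gt_eqF.
have Ix : lo_ideal (b / m%:R) 1 (x - lo_cst a).
  by rewrite /x addrC addKr; exact/lo_idealMl/powR_lo_ideal.
have bmn : 1 < b / m%:R * (m + n.+1)%:R.
  by rewrite natrD mulrDr ltr_wpDl// mulr_ge0 ?(ltW bm0).
(* The first summand is the Taylor remainder at [x], the second the residue of the equation solved
   by [v]. *)
apply: small_eq (smallD (small_near_comp xa Ix bmn hK) hv).
apply: nearW => t; rewrite xE.
have -> : (lo_cst (f a) + LittleOh (powR_lo_poly b0) * k) t =
  f a + t `^ b * k t by [].
by ring.
Qed.

(** With [w = z - a], [f z - f a] is [C * w ^+ m] up to an error of order [m + 1], and [w ^+ m] is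
    nonnegative. *)
Lemma even_sg_ge0 : ~~ odd m ->
  \forall z \near a, 0 <= Num.sg (derive1n m f a) * (f z - f a).
Proof.
move=> em; have [K hK] := taylor_order 1 sf m_gt0 f_eq0.
set c := derive1n m f a; have c0 : c != 0 := fm_neq0.
pose C := c / m`!%:R; have fm0 : 0 < m`!%:R :> R by rewrite ltr0n fact_gt0.
have sC : Num.sg c * C = `|C|.
  by rewrite mulrA -normrEsg normrM (gtr0_norm (_ : 0 < m`!%:R^-1))// invr_gt0.
have C0 : 0 < `|C| by rewrite normr_gt0 mulf_neq0// invr_eq0 gt_eqF.
have K0 : 0 < `|K| + 1 by rewrite ltr_wpDl.
(* Within this radius the leading term dominates the remainder; the [+ 1] keeps the denominator
   positive. *)
have e0 : 0 < `|C| / (`|K| + 1) by rewrite divr_gt0.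
apply: filterS2 hK (nbhsx_ballx a _ e0) => z.
rewrite horner_poly big_ord1 expr0 mulr1 addn0 -/c -/C exprD expr1.
rewrite /ball/= (distrC a); set w := z - a => h /ltW; rewrite ler_pdivlMr// => hw.
have wm : `|w| ^+ m = w ^+ m by rewrite -normrX ger0_norm ?exprn_even_ge0.
rewrite wm in h; have wm0 : 0 <= w ^+ m by rewrite -wm exprn_ge0.
have -> : Num.sg c * (f z - f a) =
  `|C| * w ^+ m + Num.sg c * (f z - (f a + w ^+ m * C)) by rewrite -sC; ring.
set E := f z - _ in h *.
have sE : - `|E| <= Num.sg c * E.
  rewrite lerNl (le_trans (ler_norm _))// normrN normrM normr_sg.
  by rewrite c0 mul1r.
have wK : `|w| * `|K| <= `|C|.
  by rewrite (le_trans _ hw)// mulrDr lerDl mulr1.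
have EC : K * (w ^+ m * `|w|) <= `|C| * w ^+ m.
  apply: (@le_trans _ _ (`|K| * (w ^+ m * `|w|))).
    by rewrite ler_wpM2r ?mulr_ge0// ler_norm.
  by rewrite mulrC -mulrA mulrC ler_wpM2r.
by lra.
Qed.

(** Odd roots exist for either sign of [k 0]; [h = 0], which has no leading term, is attained at [a]
    itself. *)
Lemma fermat_ext_odd : odd m -> forall h, Dinf R h ->
  exists2 x, st x = a & fermat_ext sf x = fcst (f a) + h.
Proof.
move=> om h /Dinf_lead[->|[b [b0 [k [k0 ->]]]]].
  by exists (fcst a); rewrite ?st_pi// addr0 fermat_ext_cst.
have c0 : derive1n m f a / m`!%:R != 0.
  by rewrite mulf_neq0// invr_eq0 pnatr_eq0 -lt0n fact_gt0.
have [v v0 vk] := exists_odd_root om (mulf_neq0 k0 (invr_neq0 c0)).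
have [||x xa <-] := @fermat_ext_monomial b b0 k v => //.
  by rewrite vk mulrC divfK.
by exists (pi x) => //; rewrite st_pi.
Qed.

Lemma fermat_ext_even_sub : ~~ odd m -> forall x, x 0 = a ->
  exists2 h, Dinf_ge0 R h & fermat_ext sf (pi x) =
    fcst (f a) + fcst (Num.sg (derive1n m f a)) * h.
Proof.
move=> em x xa; set S := lo_cst (Num.sg (derive1n m f a)).
pose y := LittleOh (lo_poly_comp sf (lo_funP x)).
(* This choice is forced: the sign is its own inverse because the [m]-th derivative is nonzero. *)
exists (pi (S * (y - lo_cst (f a)))).
  apply: Dinf_ge0_near.
    by rewrite -[LHS]/(S 0 * (f (x 0) - f a)) xa subrr mulr0.
  have := expands_cvg (lo_expands x); rewrite xa => /(_ _ (even_sg_ge0 em)).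
  exact.
have SS : S * S = 1 by rewrite -rmorphM -expr2 sqr_sg fm_neq0 rmorph1.
rewrite fermat_ext_pi -/y -[fcst _]/(pi (lo_cst _)) -[fcst (Num.sg _)]/(pi S).
by rewrite -rmorphM -rmorphD mulrA SS mul1r addrC subrK.
Qed.

Lemma fermat_ext_even_sup h : Dinf_ge0 R h ->
  exists2 x, st x = a & fermat_ext sf x =
    fcst (f a) + fcst (Num.sg (derive1n m f a)) * h.
Proof.
move=> /Dinf_ge0_lead[->|[b [b0 [k [k0 ->]]]]].
  by exists (fcst a); rewrite ?st_pi// mulr0 addr0 fermat_ext_cst.
set c := derive1n m f a; have c0 : c != 0 := fm_neq0.
have fm0 : 0 < m`!%:R :> R by rewrite ltr0n fact_gt0.
(* This is the value of [v ^+ m] required by the target [sgn(c) * k]: the sign turns [c] into its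
   absolute value, so a positive root exists. *)
have kc0 : 0 < k 0 * m`!%:R / `|c| by rewrite divr_gt0 ?normr_gt0 ?mulr_gt0.
have [v v0 vk] := exists_root m_gt0 kc0.
have [||x xa xE] := @fermat_ext_monomial b b0 (lo_cst (Num.sg c) * k) v.
- by rewrite gt_eqF.
- rewrite vk -[RHS]/(Num.sg c * k 0) -/c {1}(numEsg c).
  by field; rewrite normr_eq0 c0 gt_eqF.
exists (pi x); first by rewrite st_pi.
by rewrite xE -[fcst (Num.sg c)]/(pi (lo_cst (Num.sg c))) -rmorphM mulrCA.
Qed.

End FirstNonzeroDerivative.

End Image.

Theorem theorem33 (R : realType) (f : R -> R) (sf : smooth f) (a : R) :
  ((forall n : nat, (0 < n)%N -> derive1n n f a = 0) ->
    fermat_ext sf @` [set fcst a + h | h in Dinf R] = [set fcst (f a)]) /\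
  (forall m : nat,
    (0 < m)%N -> derive1n m f a <> 0 ->
    (forall n : nat, (0 < n)%N -> derive1n n f a <> 0 -> (m <= n)%N) ->
    (odd m ->
      fermat_ext sf @` [set fcst a + h | h in Dinf R] =
      [set fcst (f a) + h | h in Dinf R]) /\
    (~~ odd m ->
      fermat_ext sf @` [set fcst a + h | h in Dinf R] =
      [set fcst (f a) + fcst (Num.sg (derive1n m f a)) * h
        | h in Dinf_ge0 R])).
Proof.
split=> [f0|m m0 /eqP fm0 mmin].
  rewrite fcst_addDinf; apply/seteqP; split => [_ [x xa <-]|_ ->] /=.
    by rewrite -[x]reprK; apply: fermat_ext_flat.
  by exists (fcst a); [rewrite /= st_pi|exact: fermat_ext_cst].
have f0 i : (0 < i < m)%N -> derive1n i f a = 0.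
  move=> /andP[i0]; rewrite ltnNge; apply: contraNeq => /eqP; exact: mmin.
split=> pm.
  (* One inclusion only compares standard parts; the other needs a lifted preimage. *)
  rewrite !fcst_addDinf; apply/seteqP; split => [_ [x xa <-]|y ya] /=.
    by rewrite -[x]reprK (st_fermat_ext sf xa).
  have : [set fcst (f a) + h | h in Dinf R] y by rewrite fcst_addDinf.
  case=> h h0 <-; have [x xa xh] := fermat_ext_odd sf m0 fm0 f0 pm h0.
  by exists x.
rewrite fcst_addDinf; apply/seteqP; split => [_ [x xa <-]|_ [h h0 <-]].
  have [h h0 xh] := fermat_ext_even_sub sf m0 fm0 f0 pm xa.
  by exists h; rewrite // -xh reprK.
have [x xa xh] := fermat_ext_even_sup sf m0 fm0 f0 h0.
by exists x.
Qed.
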